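(* Let $\kappa$ be an infinite cardinal and assume $\mathrm{MA}_\kappa$. Suppose that $(X,\mathcal{E})$ and $(Y,\mathcal{F})$ are $\kappa$-generated uniformly locally finite coarse spaces. If $\mathrm{C}^*_u(X)$ and $\mathrm{C}^*_u(Y)$ are rigidly isomorphic, then $X$ and $Y$ are coarsely equivalent.
   Context: $\mathrm{MA}_\kappa$ (Martin's Axiom for $\kappa$ dense sets): for every nonempty partially ordered set $P$ with the countable chain condition and every family $\mathcal{D}$ of at most $\kappa$ dense subsets of $P$ there is a filter $G\subseteq P$ meeting every element of $\mathcal{D}$. Coarse structures. A coarse structure on a set $X$ is a collection $\mathcal{E}$ of subsets of $X\times X$ (called entourages) which contains the diagonal $\Delta_X=\{(x,x): x\in X\}$ and is closed under taking subsets, inverses $E^{-1}=\{(x,y):(y,x)\in E\}$, finite unions, and compositions $E\circ F=\{(x,y): \exists z\ (x,z)\in E,\ (z,y)\in F\}$; $(X,\mathcal{E})$ is a coarse space. The coarse structure generated by a family of subsets of $X\times X$ is the smallest coarse structure containing it. $(X,\mathcal{E})$ is $\kappa$-generated if $\mathcal{E}$ is generated by a family of at most $\kappa$ subsets of $X\times X$. A coarse space $(X,\mathcal{E})$ is uniformly locally finite if $\sup_{x\in X}|\{y\in X:(x,y)\in E\}|<\infty$ for all $E\in\mathcal{E}$. Coarse maps. Let $(X,\mathcal{E})$, $(Y,\mathcal{F})$ be coarse spaces. Maps $f,g:Z\to X$ from a set $Z$ are close if $\{(f(z),g(z)): z\in Z\}\in\mathcal{E}$. A map $f:X\to Y$ is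 coarse if for all $E\in\mathcal{E}$ there is $F\in\mathcal{F}$ such that $(x,x')\in E$ implies $(f(x),f(x'))\in F$. A coarse map $f:X\to Y$ is a coarse equivalence if there is a coarse map $g:Y\to X$ such that $g\circ f$ and $f\circ g$ are close to $\mathrm{Id}_X$ and $\mathrm{Id}_Y$; in that case the spaces are coarsely equivalent. Uniform Roe algebras. For $T\in B(\ell_2(X))$ let $\mathrm{supp}(T)=\{(x,x'):\langle T\delta_x,\delta_{x'}\rangle\ne 0\}$. The uniform Roe algebra $\mathrm{C}^*_u(X)$ is the norm closure in $B(\ell_2(X))$ of $\{T\in B(\ell_2(X)): \mathrm{supp}(T)\in\mathcal{E}\}$. $\mathrm{C}^*_u(X)$ and $\mathrm{C}^*_u(Y)$ are rigidly isomorphic if there is a unitary $U\colon\ell_2(X)\to\ell_2(Y)$ such that $T\mapsto UTU^*$ is an isomorphism from $\mathrm{C}^*_u(X)$ onto $\mathrm{C}^*_u(Y)$ and $\inf_{x\in X}\sup_{y\in Y}|\langle U\delta_x,\delta_y\rangle|>0$ and $\inf_{y\in Y}\sup_{x\in X}|\langle U^*\delta_y,\delta_x\rangle|>0$. *)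

(* Defs.v *)
From HB Require Import structures.
From mathcomp Require Import all_boot all_order all_algebra.
From mathcomp Require Import finmap complex.
From mathcomp Require Import all_classical all_reals all_analysis.
From mathcomp Require Import ring.
From mathcomp Require summability.

Set Implicit Arguments.
Unset Strict Implicit.
Unset Printing Implicit Defensive.

Import Order.TTheory GRing.Theory Num.Theory.
Import numFieldNormedType.Exports.
Import ComplexField.Normc.

Local Open Scope classical_set_scope.
Local Open Scope ring_scope.
Local Open Scope complex_scope.
Local Open Scope card_scope.

Section MartinAxiom.
Local Open Scope order_scope.
Context {d : Order.disp_t} {P : porderType d}.

Definition compatible (p q : P) : Prop := exists2 r, r <= p & r <= q.

Definition antichain (A : set P) : Prop :=
  forall p q, A p -> A q -> p <> q -> ~ compatible p q.

(* Dense in the sense of forcing, unrelated to the library's topological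
   [dense]. *)
Definition forcing_dense (D : set P) : Prop :=
  forall p, exists2 q, D q & q <= p.

(* The order-theoretic notion, as opposed to the library's [Filter]. *)
Definition forcing_filter (G : set P) : Prop :=
  [/\ G !=set0,
      (forall p q, G p -> p <= q -> G q) &
      (forall p q, G p -> G q -> exists2 r, G r & r <= p /\ r <= q)].

End MartinAxiom.

Definition ccc {d : Order.disp_t} (P : porderType d) : Prop :=
  forall A : set P, antichain A -> countable A.

(* A cardinal is given by a type K of that cardinality. *)
Definition MA (K : Type) : Prop :=
  forall (d : Order.disp_t) (P : porderType d),
    [set: P] !=set0 -> ccc P ->
    forall D : set (set P), D #<= [set: K] ->
      (forall A, D A -> forcing_dense A) ->
      exists2 G : set P, forcing_filter G & forall A, D A -> G `&` A !=set0.

Section Coarse.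

(* The composition E o F = {(x, y) | exists z, (x, z) in E, (z, y) in F} is
   written [F \; E] by the library. *)
Record coarse_structure {X : Type} (E : set (set (X * X))) : Prop := {
  coarse_diagonal : E diagonal ;
  coarse_subset : forall A B : set (X * X), A `<=` B -> E B -> E A ;
  coarse_inverse : forall A : set (X * X), E A -> E (A^-1)%relation ;
  coarse_union : forall A B : set (X * X), E A -> E B -> E (A `|` B) ;
  coarse_compose : forall A B : set (X * X), E A -> E B -> E (A \; B)%relation
}.

Definition coarse_generated {X : Type} (G : set (set (X * X))) :=
  smallest coarse_structure G.

Definition card_generated (K : Type) {X : Type} (E : set (set (X * X))) : Prop :=
  exists2 G : set (set (X * X)), G #<= [set: K] & E = coarse_generated G.

Definition uniformly_locally_finite {X : Type} (E : set (set (X * X))) : Prop :=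
  forall A, E A -> exists n : nat, forall x, [set y | A (x, y)] #<= `I_n.

Definition close_maps {X Z : Type} (E : set (set (X * X))) (f g : Z -> X) : Prop :=
  E (range (fun z => (f z, g z))).

Definition coarse_map {X Y : Type} (E : set (set (X * X)))
    (F : set (set (Y * Y))) (f : X -> Y) : Prop :=
  forall A, E A -> exists2 B, F B & forall x x', A (x, x') -> B (f x, f x').

Definition coarse_equivalence {X Y : Type} (E : set (set (X * X)))
    (F : set (set (Y * Y))) (f : X -> Y) : Prop :=
  coarse_map E F f /\
  exists g : Y -> X,
    [/\ coarse_map F E g, close_maps E (g \o f) id & close_maps F (f \o g) id].

Definition coarsely_equivalent {X Y : Type} (E : set (set (X * X)))
    (F : set (set (Y * Y))) : Prop :=
  exists f : X -> Y, coarse_equivalence E F f.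

End Coarse.

Section Ell2.
Variables (R : realType) (X : choiceType).

Definition sqsum (f : X -> R[i]) : \bar R :=
  (\esum_(x in [set: X]) (normc (f x) ^+ 2)%:E)%E.

Definition ell2_pred : {pred X -> R[i]} := mem [set f | (sqsum f < +oo)%E].

Record ell2 := Ell2 { ell2_fun :> X -> R[i] ; _ : ell2_fun \in ell2_pred }.

HB.instance Definition _ := [isSub for ell2_fun].
HB.instance Definition _ := [Choice of ell2 by <:].

Lemma sqsum_ge0 f : (0 <= sqsum f)%E.
Proof. by apply: esum_ge0 => x _; rewrite lee_fin sqr_ge0. Qed.

Lemma normcE0 (z : R[i]) : (normc z)%:C = `|z|. Proof. by case: z. Qed.

Lemma normc_ge0 (z : R[i]) : 0 <= normc z.
Proof. by case: z => a b; rewrite /normc sqrtr_ge0. Qed.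

Lemma esumZ (c : R) (a : X -> \bar R) : 0 <= c -> (forall x, 0 <= a x)%E ->
  (\esum_(x in [set: X]) (c%:E * a x) <= c%:E * \esum_(x in [set: X]) a x)%E.
Proof.
move=> c0 a0; apply: ge_ereal_sup => _ [A [finA _] <-].
rewrite -ge0_mule_fsumr //; apply: lee_wpmul2l; first by rewrite lee_fin.
by apply: esum_ge; exists A.
Qed.

(* For all t > 0, (a+b)^2 <= (1+t) a^2 + (1+1/t) b^2; summing over X. *)
Lemma sqsumD_weighted (f g : X -> R[i]) (t : R) : 0 < t ->
  (sqsum (f + g)%R <= (1 + t)%:E * sqsum f + (1 + t^-1)%:E * sqsum g)%E.
Proof.
move=> t0.
have t10 : 0 <= 1 + t by rewrite addr_ge0// ltW.
have t20 : 0 <= 1 + t^-1 by rewrite addr_ge0// invr_ge0 ltW.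
have sq0 (h : X -> R[i]) x : (0 <= (normc (h x) ^+ 2)%:E)%E.
  by rewrite lee_fin sqr_ge0.
apply: (@le_trans _ _ (\esum_(x in [set: X])
    ((1 + t)%:E * (normc (f x) ^+ 2)%:E
     + (1 + t^-1)%:E * (normc (g x) ^+ 2)%:E))%E).
  apply: le_esum => x _; rewrite -!EFinM -EFinD lee_fin /=.
  have fg : normc (f x + g x) <= normc (f x) + normc (g x) by exact: le_normcD.
  apply: (@le_trans _ _ ((normc (f x) + normc (g x)) ^+ 2)).
    by rewrite ler_sqr ?nnegrE ?addr_ge0 ?normc_ge0.
  move: (normc (f x)) (normc (g x)) => a b.
  rewrite -subr_ge0.
  suff -> : (1 + t) * a ^+ 2 + (1 + t^-1) * b ^+ 2 - (a + b) ^+ 2 =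
      t^-1 * (t * a - b) ^+ 2 by rewrite mulr_ge0 ?sqr_ge0// invr_ge0 ltW.
  by field; rewrite gt_eqF.
rewrite esumD; first by apply: leeD; apply: esumZ.
- by move=> x _; rewrite mule_ge0// lee_fin.
- by move=> x _; rewrite mule_ge0// lee_fin.
Qed.

Lemma sqsumZ (k : R[i]) (f : X -> R[i]) :
  (sqsum (k *: f)%R <= (normc k ^+ 2)%:E * sqsum f)%E.
Proof.
apply: le_trans (esumZ _ _); last 2 first.
- by rewrite sqr_ge0.
- by move=> x; rewrite lee_fin sqr_ge0.
by apply: le_esum => x _; rewrite -EFinM lee_fin [_ x]/(k * f x) normcM exprMn.
Qed.

Lemma sqsum0 : sqsum 0 = 0%E.
Proof. by apply: esum1 => x _; rewrite normc0 expr0n. Qed.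

Lemma ell2_submod_closed : submod_closed ell2_pred.
Proof.
split=> [|k f g]; first by rewrite inE /= sqsum0.
rewrite !inE /= => fX gX.
apply: (le_lt_trans (sqsumD_weighted _ _ ltr01)); apply: lte_add_pinfty.
  apply: (@le_lt_trans _ _ ((1 + 1)%:E * ((normc k ^+ 2)%:E * sqsum f))%E).
    by apply: lee_wpmul2l; [rewrite lee_fin addr_ge0|exact: sqsumZ].
  by rewrite !lte_mul_pinfty// lee_fin ?addr_ge0 ?sqr_ge0.
by rewrite lte_mul_pinfty// lee_fin addr_ge0// invr_ge0.
Qed.

HB.instance Definition _ := GRing.isSubmodClosed.Build _ _ ell2_pred
  ell2_submod_closed.
HB.instance Definition _ := [SubChoice_isSubLmodule of ell2 by <:].

Definition ell2_norm (f : ell2) : R := Num.sqrt (fine (sqsum f)).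

Lemma ell2_fin (f : ell2) : sqsum f \is a fin_num.
Proof.
case: f => f /=; rewrite inE /= => fX.
by rewrite fin_numElt fX (lt_le_trans _ (sqsum_ge0 f)).
Qed.

Lemma ell2_norm_ge0 (f : ell2) : 0 <= ell2_norm f.
Proof. exact: sqrtr_ge0. Qed.

Lemma sqr_ell2_norm (f : ell2) : (ell2_norm f ^+ 2)%:E = sqsum f.
Proof. by rewrite sqr_sqrtr ?fine_ge0 ?sqsum_ge0// fineK// ell2_fin. Qed.

Lemma ell2_norm_eq0 (f : ell2) : ell2_norm f = 0 -> f = 0.
Proof.
move=> f0; apply/val_inj/funext => x /=.
have : ((normc (f x) ^+ 2)%:E <= sqsum f)%E.
  apply: esum_ge; exists [set x]; first by split; [exact: finite_set1|].
  by rewrite fsbig_set1.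
rewrite -sqr_ell2_norm f0 expr0n /= lee_fin => h.
by apply/eq0_normc/eqP; rewrite -sqrf_eq0 eq_le h sqr_ge0.
Qed.

Lemma ell2_norm_leD (f g : ell2) : ell2_norm (f + g) <= ell2_norm f + ell2_norm g.
Proof.
have [f0|fN0] := eqVneq (ell2_norm f) 0.
  by rewrite (ell2_norm_eq0 f0) !add0r lerDr ell2_norm_ge0.
have [g0|gN0] := eqVneq (ell2_norm g) 0.
  by rewrite (ell2_norm_eq0 g0) !addr0 lerDl ell2_norm_ge0.
have fp : 0 < ell2_norm f by rewrite lt_neqAle eq_sym fN0 ell2_norm_ge0.
have gp : 0 < ell2_norm g by rewrite lt_neqAle eq_sym gN0 ell2_norm_ge0.
rewrite -ler_sqr ?nnegrE ?addr_ge0 ?ell2_norm_ge0//.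
rewrite -lee_fin sqr_ell2_norm.
apply: le_trans (sqsumD_weighted _ _ (divr_gt0 gp fp)) _.
rewrite -!sqr_ell2_norm -!EFinM -EFinD lee_fin.
rewrite le_eqVlt; apply/orP; left; apply/eqP.
by field; rewrite fN0 gN0.
Qed.

Lemma ell2_normZ_le (k : R[i]) (f : ell2) :
  ell2_norm (k *: f) <= normc k * ell2_norm f.
Proof.
rewrite -ler_sqr ?nnegrE ?mulr_ge0 ?normc_ge0 ?ell2_norm_ge0//.
by rewrite -lee_fin sqr_ell2_norm exprMn EFinM sqr_ell2_norm sqsumZ.
Qed.

Lemma ell2_normZ (k : R[i]) (f : ell2) :
  ell2_norm (k *: f) = normc k * ell2_norm f.
Proof.
apply/eqP; rewrite eq_le ell2_normZ_le /=.
have [->|k0] := eqVneq k 0; first by rewrite normc0 mul0r ell2_norm_ge0.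
have nk : 0 < normc k by rewrite lt_neqAle normc_ge0 andbT eq_sym;
  apply: contra k0 => /eqP/eq0_normc ->.
rewrite -ler_pdivlMl// -normcV -[f in leLHS](scalerK k0).
exact: ell2_normZ_le.
Qed.

Let nrm (f : ell2) : R[i] := (ell2_norm f)%:C.

Let nrmD f g : nrm (f + g) <= nrm f + nrm g.
Proof. by rewrite /nrm -rmorphD lecR ell2_norm_leD. Qed.

Let nrmZ k f : nrm (k *: f) = `|k| * nrm f.
Proof. by rewrite /nrm ell2_normZ -normcE0 -rmorphM. Qed.

Let nrm_eq0 f : nrm f = 0 -> f = 0.
Proof. by case=> /ell2_norm_eq0. Qed.

HB.instance Definition _ :=
  @Lmodule_isNormed.Build R[i] ell2 nrm nrmD nrmZ nrm_eq0.

(* Linear in the first argument. The sum is the unordered sum, i.e. the limit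
   of the finite partial sums along the directed set of finite subsets of X. *)
Definition dot (f g : ell2) : R[i] :=
  summability.sum (fun x => f x * (g x)^* : R[i]^o).

Definition delta_fun (x : X) : X -> R[i] := fun y => (y == x)%:R.

Lemma delta_subproof x : delta_fun x \in ell2_pred.
Proof.
rewrite inE /= /sqsum.
rewrite (_ : (\esum_(y in _) _)%E = (\esum_(y in [set x]) 1)%E); last first.
  rewrite [RHS]esum_mkcond; apply: eq_esum => y _.
  have -> : (y \in [set x]) = (y == x) by apply/idP/eqP; rewrite inE.
  by rewrite /delta_fun; case: (y == x); rewrite ?normc1 ?normc0 ?expr1n ?expr0n.
by rewrite esum_set1 ?ltry// lee01.
Qed.

Definition delta (x : X) : ell2 := Ell2 (delta_subproof x).

End Ell2.

Section BoundedOperators.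
Variables (R : realType) (V W : normedModType R[i]).

Definition op_bound (f : V -> W) (M : R) : Prop :=
  forall v, `|f v| <= M%:C * `|v|.

Definition bounded_op_pred : {pred V -> W} :=
  mem [set f | linear f /\ exists M, op_bound f M].

Record bounded_op := BoundedOp {
  bounded_op_fun :> V -> W ; _ : bounded_op_fun \in bounded_op_pred }.

HB.instance Definition _ := [isSub for bounded_op_fun].
HB.instance Definition _ := [Choice of bounded_op by <:].

Lemma bounded_op_linear (T : bounded_op) : linear T.
Proof. by case: T => f /=; rewrite inE => -[]. Qed.

HB.instance Definition _ (T : bounded_op) :=
  GRing.isLinear.Build _ _ _ _ (bounded_op_fun T) (bounded_op_linear T).

Lemma bounded_op_bounded (T : bounded_op) : exists M, op_bound T M.
Proof. by case: T => f /=; rewrite inE => -[]. Qed.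

Lemma op_boundD f g M N : op_bound f M -> op_bound g N -> op_bound (f + g) (M + N).
Proof.
move=> fM gN v; rewrite rmorphD mulrDl.
by apply: le_trans (ler_normD _ _) _; exact: lerD.
Qed.

Lemma op_boundZ (k : R[i]) f M : op_bound f M -> op_bound (k *: f) (normc k * M).
Proof.
move=> fM v; rewrite [(k *: f) v]/(k *: f v) normrZ -normcE0 rmorphM -mulrA.
by apply: ler_wpM2l; rewrite ?lecR ?normc_ge0//; exact: fM.
Qed.

Lemma bounded_op_submod_closed : submod_closed bounded_op_pred.
Proof.
split=> [|k f g].
  rewrite inE /=; split; first by move=> a u v /=; rewrite scaler0 addr0.
  by exists 0 => v; rewrite normr0 mul0r.
rewrite !inE /= => -[lf [M fM]] [lg [N gN]]; split.
  move=> a u v; rewrite ![(_ + _) _]/(k *: f _ + g _) lf lg.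
  by rewrite !scalerDr !scalerA [k * a]mulrC addrACA.
by exists (normc k * M + N); apply: op_boundD => //; exact: op_boundZ.
Qed.

HB.instance Definition _ := GRing.isSubmodClosed.Build _ _ bounded_op_pred
  bounded_op_submod_closed.
HB.instance Definition _ := [SubChoice_isSubLmodule of bounded_op by <:].

Definition op_norm (T : bounded_op) : R :=
  inf [set M : R | 0 <= M /\ op_bound T M].

Let op_norm_has_inf (T : bounded_op) :
  has_inf [set M : R | 0 <= M /\ op_bound T M].
Proof.
split; last by exists 0 => M [].
have [M TM] := bounded_op_bounded T; exists `|M|; split => // v.
by apply: le_trans (TM v) _; rewrite ler_wpM2r// lecR ler_norm.
Qed.

Lemma op_norm_ge0 (T : bounded_op) : 0 <= op_norm T.
Proof. by apply: lb_le_inf; [case: (op_norm_has_inf T)|move=> M []]. Qed.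

Lemma op_norm_le (T : bounded_op) (M : R) : 0 <= M -> op_bound T M -> op_norm T <= M.
Proof. by move=> M0 TM; apply: ge_inf; [case: (op_norm_has_inf T)|]. Qed.

Lemma normv_real (U : normedModType R[i]) (v : U) : (complex.Re `|v|)%:C = `|v|.
Proof. by rewrite RRe_real// ger0_real. Qed.

Lemma op_norm_bound (T : bounded_op) : op_bound T (op_norm T).
Proof.
move=> v; rewrite -[ `|T v| ]normv_real -[ `|v| ]normv_real -rmorphM lecR.
apply/ler_addgt0Pr => e e0.
set a := complex.Re `|v|.
have a0 : 0 <= a by rewrite -lecR normv_real normr_ge0.
have e'0 : 0 < e / (a + 1) by rewrite divr_gt0// ltr_wpDl.
have [M [M0 TM] Me] := inf_adherent e'0 (op_norm_has_inf T).
have h : complex.Re `|T v| <= M * a.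
  by have := TM v; rewrite -[ `|T v| ]normv_real -[ `|v| ]normv_real -rmorphM lecR.
apply: le_trans h _.
apply: (@le_trans _ _ ((op_norm T + e / (a + 1)) * a)).
  by rewrite ler_wpM2r// ltW.
rewrite mulrDl lerD2l -mulrA ger_pMr// mulrC ler_pdivrMr ?ltr_wpDl//.
by rewrite mul1r lerDl.
Qed.

Let onrm (T : bounded_op) : R[i] := (op_norm T)%:C.

Let onrmD S T : onrm (S + T) <= onrm S + onrm T.
Proof.
rewrite /onrm -rmorphD lecR; apply: op_norm_le.
  by rewrite addr_ge0// op_norm_ge0.
by apply: op_boundD; exact: op_norm_bound.
Qed.

Let op_normZ_le k T : op_norm (k *: T) <= normc k * op_norm T.
Proof.
apply: op_norm_le; first by rewrite mulr_ge0 ?normc_ge0 ?op_norm_ge0.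
by apply: op_boundZ; exact: op_norm_bound.
Qed.

Let onrmZ k T : onrm (k *: T) = `|k| * onrm T.
Proof.
rewrite /onrm -normcE0 -rmorphM; congr (_%:C).
apply/eqP; rewrite eq_le op_normZ_le /=.
have [->|k0] := eqVneq k 0; first by rewrite normc0 mul0r op_norm_ge0.
have nk : 0 < normc k by rewrite lt_neqAle normc_ge0 andbT eq_sym;
  apply: contra k0 => /eqP/eq0_normc ->.
rewrite -ler_pdivlMl// -normcV -[T in leLHS](scalerK k0).
exact: op_normZ_le.
Qed.

Let onrm_eq0 T : onrm T = 0 -> T = 0.
Proof.
case=> T0; apply/val_inj/funext => v /=; apply/eqP; rewrite -normr_le0.
by apply: le_trans (op_norm_bound T v) _; rewrite T0 mul0r.
Qed.

HB.instance Definition _ :=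
  @Lmodule_isNormed.Build R[i] bounded_op onrm onrmD onrmZ onrm_eq0.

End BoundedOperators.

Section Composition.
Variables (R : realType) (U V W : normedModType R[i]).

Lemma comp_op_subproof (S : bounded_op V W) (T : bounded_op U V) :
  S \o T \in @bounded_op_pred R U W.
Proof.
rewrite inE /=; split; first by move=> a u v /=; rewrite !linearP.
exists (op_norm S * op_norm T) => v /=.
apply: le_trans (op_norm_bound S (T v)) _; rewrite rmorphM -mulrA.
by rewrite ler_wpM2l ?lecR ?op_norm_ge0//; exact: op_norm_bound.
Qed.

Definition comp_op (S : bounded_op V W) (T : bounded_op U V) : bounded_op U W :=
  BoundedOp (comp_op_subproof S T).

End Composition.

Section UniformRoe.
Variables (R : realType).

Definition supp {X : choiceType} (T : bounded_op (ell2 R X) (ell2 R X)) :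
    set (X * X) :=
  [set xx | dot (T (delta R xx.1)) (delta R xx.2) != 0].

(* The closure is taken in the operator norm topology on B(l_2(X)). *)
Definition uniform_roe {X : choiceType} (E : set (set (X * X))) :
    set (bounded_op (ell2 R X) (ell2 R X)) :=
  closure [set T | E (supp T)].

Definition adjoint_of {X Y : choiceType} (T : bounded_op (ell2 R X) (ell2 R Y))
    (S : bounded_op (ell2 R Y) (ell2 R X)) : Prop :=
  forall f g, dot (T f) g = dot f (S g).

(* [Us] is the adjoint of the unitary [U]. *)
Definition unitary {X Y : choiceType} (U : bounded_op (ell2 R X) (ell2 R Y))
    (Us : bounded_op (ell2 R Y) (ell2 R X)) : Prop :=
  [/\ adjoint_of U Us, cancel U Us & cancel Us U].

(* T |-> U T U^* is automatically a *-homomorphism B(l_2(X)) -> B(l_2(Y)) when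
   U is unitary, so being an isomorphism between the Roe algebras means
   restricting to a bijection between them.  Infima and suprema are taken in
   the extended reals, so that an infimum over the empty set is +oo. *)
Definition rigidly_isomorphic {X Y : choiceType} (E : set (set (X * X)))
    (F : set (set (Y * Y))) : Prop :=
  exists (U : bounded_op (ell2 R X) (ell2 R Y))
         (Us : bounded_op (ell2 R Y) (ell2 R X)),
    [/\ unitary U Us,
        set_bij (uniform_roe E) (uniform_roe F)
          (fun T => comp_op (comp_op U T) Us),
        (0 < ereal_inf (range (fun x => ereal_sup (range (fun y =>
          (normc (dot (U (delta R x)) (delta R y)))%:E)))))%E &
        (0 < ereal_inf (range (fun y => ereal_sup (range (fun x =>
          (normc (dot (Us (delta R y)) (delta R x)))%:E)))))%E].

End UniformRoe.

(* Main.v *)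
(* Write U_xy for the coefficient of U delta_x at delta_y.  Rigidity gives d > 0
   and maps f : X -> Y, g : Y -> X with |U_{x,f x}| >= d and |U_{g y,y}| >= d,
   and everything reduces to: for A in E, the set of (y, y') such that
   |U_xy|, |U_x'y'| >= d for some (x, x') in A belongs to F.
   Index these data by quadruples j = (x, x', y, y').  If J is a set of
   quadruples whose pairs (x, x') form the graph of a partial injection, with
   associated partial isometry v, the coefficient of U v U^* at (y, y') is a sum
   over J whose own term has modulus >= d^2, and the other terms are bounded by
   w(j, j') = |U_{a j', y}| |U_{b j', y'}|, where (a j', b j') is the first pair
   of j'.  By uniform local finiteness and boundedness of U, the weights w have
   uniformly bounded row and column sums, even after adding 1 to w(j, j') when
   j, j' share a or b.  Hence the quadruples can be split into finitely many
   classes inside which the off-diagonal row sums are small: in the finite case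
   minimise the total weight inside the classes, in general take a limit along
   an ultrafilter.  Each class gives an operator U v U^* in the Roe algebra of Y
   with large coefficients at all its pairs (y, y'), and the large coefficients
   of an operator in a uniform Roe algebra form an entourage. *)
Require Import Defs.
From mathcomp Require Import all_boot all_order all_algebra.
From mathcomp Require Import finmap complex.
From mathcomp Require Import all_classical all_reals all_analysis.
From mathcomp Require Import ring lra.
From mathcomp Require summability.

Set Implicit Arguments.
Unset Strict Implicit.
Unset Printing Implicit Defensive.

Import Order.TTheory GRing.Theory Num.Theory.
Import numFieldNormedType.Exports.
Import ComplexField.Normc.

Local Open Scope classical_set_scope.
Local Open Scope ring_scope.
Local Open Scope complex_scope.
Local Open Scope card_scope.

(** * Splitting an index set into finitely many classes of small internal weight *)

Section Paving.
Variable R : realType.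

(** Minimise over all colourings the total weight between distinct points of equal colour. At a
    minimum no recolouring of a single point helps, so its cost in its own class is at most the
    average over the [k.+1] classes, and these costs add up to at most [2 * C]. *)
Lemma paving_finite (T : finType) (w : T -> T -> R) (C : R) (k : nat) :
  (forall i, \sum_j w i j <= C) -> (forall j, \sum_i w i j <= C) ->
  (forall i j, 0 <= w i j) ->
  exists c : T -> 'I_k.+1, forall i,
    \sum_(j | (j != i) && (c j == c i)) w i j <= 2 * C / k.+1%:R.
Proof.
move=> rowC colC w0.
pose En (c : {ffun T -> 'I_k.+1}) :=
  \sum_i \sum_j (if (j != i) && (c j == c i) then w i j else 0).
have [c _ cmin] := @Order.TotalTheory.arg_minP _ _ _
  [ffun=> ord0 : 'I_k.+1] xpredT En isT.
exists c => i0.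
(* [D f l] is the weight, in both directions, between [i0] and the other points of colour [l]. [A]
   collects the pairs avoiding [i0], hence ignores the colour of [i0]. *)
pose D (f : T -> 'I_k.+1) (l : 'I_k.+1) :=
  \sum_(j | j != i0) (if f j == l then w i0 j + w j i0 else 0).
pose A (f : T -> 'I_k.+1) := \sum_(i | i != i0) \sum_(j | j != i0)
  (if (j != i) && (f j == f i) then w i j else 0).
have EnE f : En f = A f + D f (f i0).
  rewrite /En (bigD1 i0)//= (bigD1 i0)//= eqxx add0r.
  rewrite [X in _ + X](eq_bigr (fun i =>
     (if f i == f i0 then w i i0 else 0) + \sum_(j | j != i0)
  (if (j != i) && (f j == f i) then w i j else 0))); last first.
    move=> i ii0; rewrite (bigD1 i0)//=; congr (_ + _).
    by rewrite eq_sym ii0 /= eq_sym.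
  rewrite big_split /= addrA addrC; congr (_ + _).
  rewrite -big_split /=; apply: eq_bigr => j ji0; rewrite ji0 /=.
  by case: ifP => //; rewrite addr0.
have step l : D c (c i0) <= D c l.
  pose c' := [ffun j => if j == i0 then l else c j].
  have := cmin c' isT; rewrite !EnE.
  have -> : A c' = A c.
    apply: eq_bigr => i ii0; apply: eq_bigr => j ji0.
    by rewrite !ffunE (negbTE ii0) (negbTE ji0).
  rewrite lerD2l ffunE eqxx => /le_trans; apply.
  apply: ler_sum => j ji0; by rewrite ffunE (negbTE ji0).
(* Each [j] is counted only for its own colour, so what remains is one row sum plus one column
   sum. *)
have sumD : \sum_l D c l <= 2 * C.
  rewrite /D exchange_big /=.
  apply: (@le_trans _ _ (\sum_j (w i0 j + w j i0))).
    rewrite [leRHS](bigID (fun j => j != i0))/= ler_wpDr//.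
      by apply: sumr_ge0 => j _; rewrite addr_ge0.
    apply: ler_sum => j _; rewrite -big_mkcond /= (big_pred1 (c j))//.
  by rewrite big_split /= mulr_natl mulr2n lerD.
have : D c (c i0) <= 2 * C / k.+1%:R.
  rewrite ler_pdivlMr ?ltr0n// mulrC; apply: le_trans sumD.
  apply: le_trans (ler_sum _ (fun l _ => step l)).
  by rewrite sumr_const card_ord mulr_natl.
apply: le_trans; rewrite /D -big_mkcondr /=.
by apply: ler_sum => j _; rewrite lerDl.
Qed.

Lemma sum_seq_le (J : choiceType) (f : J -> R) (s t : seq J) :
  uniq s -> {subset s <= t} -> (forall j, 0 <= f j) ->
  \sum_(j <- s) f j <= \sum_(j <- t) f j.
Proof.
move=> us st f0.
have ut : uniq (undup t) by exact: undup_uniq.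
apply: (@le_trans _ _ (\sum_(j <- undup t) f j)).
  rewrite [leRHS](bigID (mem s))/= -[X in _ <= X + _]big_filter.
  rewrite (@perm_big _ _ _ _ [seq i <- undup t | mem s i] s).
    by rewrite lerDl sumr_ge0.
  apply: uniq_perm; rewrite ?filter_uniq// => j.
  rewrite mem_filter mem_undup /=; case js: (j \in s) => //=.
  by rewrite st.
elim: t {st ut} => [|a t IH] /=; first by rewrite !big_nil.
case: ifP => _; rewrite !big_cons; first by rewrite (le_trans IH)// lerDr.
by rewrite lerD2l.
Qed.

Lemma paving_fset (J : choiceType) (w : J -> J -> R) (C : R) (k : nat) :
  (forall i j, 0 <= w i j) ->
  (forall i s, uniq s -> \sum_(j <- s) w i j <= C) ->
  (forall j s, uniq s -> \sum_(i <- s) w i j <= C) ->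
  forall A : {fset J}, exists c : J -> 'I_k.+1, forall i s, i \in A ->
    uniq s -> {subset s <= A} -> (forall j, j \in s -> j != i /\ c j = c i) ->
    \sum_(j <- s) w i j <= 2 * C / k.+1%:R.
Proof.
move=> w0 rowC colC A.
have sumA (f : J -> R) : \sum_(j : A) f (val j) = \sum_(j <- enum_fset A) f j.
  by rewrite big_seq_fsetE.
have [|||c cP] := @paving_finite A (fun i j => w (val i) (val j)) C k.
- by move=> i; rewrite sumA; exact: rowC.
- by move=> j; rewrite (sumA (fun i => w i (val j))); exact: colC.
- by move=> i j; exact: w0.
(* The colour off [A] is arbitrary, since only points of [A] are compared. *)
pose c' j := if insub j is Some u then c u else ord0.
have c'E (u : A) : c' (val u) = c u by rewrite /c' valK.
exists c' => i s iA us sA cs.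
apply: le_trans (cP [` iA]%fset).
pose f j := if (j != i) && (c' j == c' i) then w i j else 0.
rewrite [leRHS]big_mkcond /=.
rewrite [leRHS](eq_bigr (fun u : A => f (val u))) => [|u _]; last first.
  by rewrite /f c'E (c'E [` iA]%fset : c' i = _) -val_eqE.
rewrite (eq_big_seq f) => [|j /cs[ji cji]]; last by rewrite /f ji cji eqxx.
rewrite sumA; apply: sum_seq_le => // j; rewrite /f; by case: ifP.
Qed.

(** Compactness: colourings good on each finite set converge pointwise along an ultrafilter of
    finite sets. A bound on [i :: s] involves finitely many colours, so some single finite set [A]
    containing [i :: s] has a colouring that already agrees with the limit there. *)
Lemma paving (J : choiceType) (w : J -> J -> R) (C eps : R) :
  0 < eps ->
  (forall i j, 0 <= w i j) ->
  (forall i s, uniq s -> \sum_(j <- s) w i j <= C) ->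
  (forall j s, uniq s -> \sum_(i <- s) w i j <= C) ->
  exists k (c : J -> 'I_k.+1), forall i s,
    uniq s -> (forall j, j \in s -> j != i /\ c j = c i) ->
    \sum_(j <- s) w i j <= eps.
Proof.
move=> e0 w0 rowC colC.
pose k := Num.truncn (eps^-1 * (2 * C)).
have kP : 2 * C / k.+1%:R <= eps.
  by rewrite ler_pdivrMr ?ltr0n// -ler_pdivrMl// ltW// /k truncnS_gt.
have /choice[cA cAP] := paving_fset k w0 rowC colC.
have [G [GU GT]] := ultraFilterLemma (@summability.totally_filter J).
have GF := @ultra_proper _ _ GU.
have lim i : exists l, G [set A | cA A i = l].
  apply: contrapT => /forallNP nG.
  (* There are finitely many colours, so if every one were rejected [G]-often, some [A] would give
     [i] no colour at all. *)
  have nGl l : G (~` [set A | cA A i = l]).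
    by case: (in_ultra_setVsetC [set A | cA A i = l] GU) => // /nG.
  have [A AP] := @filter_ex _ _ GF _ (@filter_forall _ _ _ G _ nGl).
  exact: (AP (cA A i)).
have /choice[c cP] := lim.
exists k, c => i s us sc.
have GS : G [set A | [fset j in i :: s] `<=` A]%fset.
  by apply: GT; exists [fset j in i :: s]%fset.
have Gs : G (\bigcap_(j in [set` [fset j in i :: s]%fset]) [set A | cA A j = c j]).
  by apply: filter_bigI => j _; exact: cP.
have [A [/= /fsubsetP sA Ac]] := @filter_ex _ _ GF _ (filterI GS Gs).
have cE j : j \in i :: s -> cA A j = c j.
  by move=> ji; apply: Ac; rewrite /= !inE in ji *.
apply: le_trans (cAP A i s _ us _ _) kP.
- by apply: sA; rewrite !inE eqxx.
- by move=> j js; apply: sA; rewrite !inE js orbT.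
- move=> j js; have [ji cji] := sc j js; split => //.
  by rewrite !cE// !inE ?eqxx// js orbT.
Qed.

End Paving.

(** * Finite truncations and coordinates in the space of square-summable functions *)

Section Ell2Theory.
Variables (R : realType) (X : choiceType).
Implicit Types (f g : ell2 R X) (s t : seq X) (x y : X).

Lemma sqsum_le_seq (f : X -> R[i]) (M : R) :
  (forall s, uniq s -> \sum_(x <- s) normc (f x) ^+ 2 <= M) ->
  (sqsum f <= M%:E)%E.
Proof.
move=> fM; apply: ge_ereal_sup => _ [A [finA _] <-].
by rewrite fsbig_finite// sumEFin lee_fin; apply: fM; exact: fset_uniq.
Qed.

Lemma sum_sqr_le_norm f s : uniq s ->
  \sum_(x <- s) normc (f x) ^+ 2 <= ell2_norm f ^+ 2.
Proof.
move=> us; rewrite -lee_fin sqr_ell2_norm -sumEFin; apply: esum_ge.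
by exists [set` s]; [split|rewrite -fsbig_seq].
Qed.

Lemma ell2_norm_le f (M : R) : 0 <= M ->
  (forall s, uniq s -> \sum_(x <- s) normc (f x) ^+ 2 <= M ^+ 2) ->
  ell2_norm f <= M.
Proof.
move=> M0 fM; rewrite -ler_sqr ?nnegrE ?ell2_norm_ge0//.
by rewrite -lee_fin sqr_ell2_norm; exact: sqsum_le_seq.
Qed.

Lemma normc_le_ell2_norm f x : normc (f x) <= ell2_norm f.
Proof.
rewrite -ler_sqr ?nnegrE ?ell2_norm_ge0 ?normc_ge0//.
by have := @sum_sqr_le_norm f [:: x] isT; rewrite big_seq1.
Qed.

Lemma ell2DE f g x : (f + g) x = f x + g x. Proof. by []. Qed.
Lemma ell2BE f g x : (f - g) x = f x - g x. Proof. by []. Qed.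
Lemma ell2ZE (k : R[i]) f x : (k *: f) x = k * f x. Proof. by []. Qed.

Lemma ell2_sumE (I : Type) (r : seq I) (F : I -> ell2 R X) x :
  (\sum_(i <- r) F i) x = \sum_(i <- r) F i x.
Proof. by elim/big_rec2 : _ => // i u v _ <-. Qed.

Definition truncation f s : ell2 R X := \sum_(x <- s) f x *: delta R x.

Lemma truncationE f s x : uniq s ->
  truncation f s x = if x \in s then f x else 0.
Proof.
move=> us; rewrite ell2_sumE.
under eq_bigr do rewrite ell2ZE.
case: ifPn => xs.
  rewrite (bigD1_seq x)//= /delta_fun eqxx mulr1 big1 ?addr0// => y yx.
  by rewrite eq_sym (negbTE yx) mulr0.
rewrite big1_seq// => y /= ys; rewrite /delta_fun.
case: eqVneq => [xy|_]; last by rewrite mulr0.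
by rewrite xy ys in xs.
Qed.

Lemma truncation_approx f (e : R) : 0 < e ->
  exists s, forall t, uniq t -> {subset s <= t} ->
    ell2_norm (f - truncation f t) <= e.
Proof.
move=> e0.
(* The squared norm is the supremum of the finite partial sums, so [s] captures all of it but
   [e ^+ 2]. *)
have [s us sP] : exists2 s, uniq s &
    ell2_norm f ^+ 2 - e ^+ 2 < \sum_(x <- s) normc (f x) ^+ 2.
  apply: contrapT => H.
  have : (sqsum f <= (ell2_norm f ^+ 2 - e ^+ 2)%:E)%E.
    apply: sqsum_le_seq => s us; rewrite leNgt; apply/negP => sf.
    by apply: H; exists s.
  by rewrite -sqr_ell2_norm lee_fin leNgt ltrBlDr ltrDl exprn_gt0.
exists s => t ut st; apply: ell2_norm_le => [|r ur]; first exact: ltW.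
have -> : \sum_(x <- r) normc ((f - truncation f t) x) ^+ 2 =
    \sum_(x <- [seq x <- r | x \notin t]) normc (f x) ^+ 2.
  rewrite big_filter [RHS]big_mkcond; apply: eq_bigr => x _.
  rewrite ell2BE truncationE//.
  by case: (x \in t) => /=; rewrite ?subr0// subrr normc0 expr0n.
set q := [seq x <- r | _].
(* The part [q] seen by the remainder is disjoint from [s], so both sums together stay below the
   squared norm. *)
have uqs : uniq (q ++ s).
  rewrite cat_uniq filter_uniq//= us andbT; apply/hasPn => x xs.
  by rewrite mem_filter st.
have := sum_sqr_le_norm f uqs; rewrite big_cat /=.
move: sP; lra.
Qed.

(** The net of partial sums is constant once the finite set contains [x]. *)
Lemma sum_supported1 (F : X -> R[i]^o) x :
  (forall y, y != x -> F y = 0) -> summability.sum F = F x.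
Proof.
move=> F0; rewrite /summability.sum.
have FF := @summability.totally_filter X.
apply: (@lim_near_cst _ (@norm_hausdorff R[i] R[i]^o) _ _ FF).
exists [fset x]%fset => // A /= /fsubsetP xA.
have xinA : x \in A by apply: xA; rewrite inE.
rewrite /summability.partial_sum -(big_seq_fsetE _ _ xpredT F)/= (bigD1_seq x)//=.
by rewrite big1 ?addr0.
Qed.

Lemma dot_deltar f x : dot f (delta R x) = f x.
Proof.
rewrite /dot (sum_supported1 (x := x)) => [|y yx] /=.
  by rewrite /delta_fun eqxx conjC1 mulr1.
by rewrite /delta_fun (negbTE yx) conjC0 mulr0.
Qed.

Lemma dot_deltal f x : dot (delta R x) f = Num.conj (f x).
Proof.
rewrite /dot (sum_supported1 (x := x)) => [|y yx] /=.
  by rewrite /delta_fun eqxx mul1r.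
by rewrite /delta_fun (negbTE yx) mul0r.
Qed.

Lemma normc_conj (z : R[i]) : normc (Num.conj z) = normc z.
Proof. by apply: complexI; rewrite !normcE0 norm_conjC. Qed.

Lemma ell2_norm_delta x : ell2_norm (delta R x) <= 1.
Proof.
apply: ell2_norm_le => // s us; rewrite expr1n.
have [xs|xs] := boolP (x \in s).
  rewrite (bigD1_seq x)//= big1 => [|y yx]; rewrite /delta_fun ?eqxx.
    by rewrite normc1 expr1n addr0.
  by rewrite (negbTE yx) normc0 expr0n.
rewrite big1_seq// => y /= ys; rewrite /delta_fun.
case: eqVneq => [yx|_]; last by rewrite normc0 expr0n.
by rewrite -yx ys in xs.
Qed.

End Ell2Theory.

(** * Matrix coefficients of bounded operators *)

Section Operators.
Variable R : realType.

Lemma op_norm_ell2 (X Y : choiceType) (T : bounded_op (ell2 R X) (ell2 R Y)) f :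
  ell2_norm (T f) <= op_norm T * ell2_norm f.
Proof. by have := op_norm_bound T f; rewrite /Num.norm/= -rmorphM lecR. Qed.

Lemma op_norm_delta (X Y : choiceType) (T : bounded_op (ell2 R X) (ell2 R Y)) x :
  ell2_norm (T (delta R x)) <= op_norm T.
Proof.
apply: le_trans (op_norm_ell2 _ _) _.
by rewrite ler_piMr ?op_norm_ge0// ell2_norm_delta.
Qed.

(** Formally [T g y] is the sum of the terms [g x * T (delta R x) y]. Truncating [g] to a finite set
    containing [z] makes this exact up to an arbitrarily small error, and the triangle inequality
    then isolates the term at [z]. *)
Lemma coef_ge (X Y : choiceType) (T : bounded_op (ell2 R X) (ell2 R Y))
    (g : ell2 R X) (y : Y) (z : X) (eps : R) :
  (forall s, uniq s -> z \notin s ->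
    \sum_(x <- s) normc (g x) * normc (T (delta R x) y) <= eps) ->
  normc (g z) * normc (T (delta R z) y) - eps <= normc (T g y).
Proof.
move=> H; apply/ler_addgt0Pl => e e0.
(* Adding 1 keeps the divisor positive even when [T] is zero. *)
have M0 : 0 < op_norm T + 1 by rewrite ltr_wpDl ?op_norm_ge0.
have [s sP] := truncation_approx g (divr_gt0 e0 M0).
pose t := undup (z :: s).
have ut : uniq t by exact: undup_uniq.
have zt : z \in t by rewrite mem_undup inE eqxx.
have {sP} tP : ell2_norm (g - truncation g t) <= e / (op_norm T + 1).
  by apply: sP => // x xs; rewrite mem_undup inE xs orbT.
pose r := rem z t.
have ur : uniq r by exact: rem_uniq.
have zr : z \notin r by rewrite mem_rem_uniq// inE eqxx.
have TgE : T (truncation g t) y =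
    g z * T (delta R z) y + \sum_(x <- r) g x * T (delta R x) y.
  rewrite /truncation (perm_big _ (perm_to_rem zt)) linear_sum ell2_sumE big_cons.
  by congr (_ + _); [|apply: eq_bigr => x _]; rewrite linearZ.
have h1 : normc (T (g - truncation g t) y) <= e.
  apply: le_trans (normc_le_ell2_norm _ _) _.
  apply: le_trans (op_norm_ell2 _ _) _.
  apply: le_trans (ler_wpM2l (op_norm_ge0 _) tP) _.
  by rewrite mulrCA ger_pMr// ler_pdivrMr// mul1r lerDl.
have h2 : normc (\sum_(x <- r) g x * T (delta R x) y) <= eps.
  apply: le_trans (H r ur zr).
  elim: (r) => [|x r' IH]; first by rewrite !big_nil normc0.
  by rewrite !big_cons (le_trans (le_normcD _ _))// normcM lerD2l.
have -> : T g y = T (g - truncation g t) y + T (truncation g t) y.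
  by rewrite -ell2DE -linearD subrK.
set a := T (g - _) y; set b := \sum_(x <- r) _ in TgE h2.
rewrite TgE -normcM.
have : normc (g z * T (delta R z) y) <=
    normc (a + (g z * T (delta R z) y + b)) + normc a + normc b.
  rewrite -[normc a]normcN -[normc b]normcN.
  rewrite [leLHS](_ : _ = normc (a + (g z * T (delta R z) y + b) + - a + - b)).
    by apply: le_trans (le_normcD _ _) _; rewrite lerD2r le_normcD.
  by congr normc; ring.
move: h1 h2; rewrite -/a; lra.
Qed.

(** Take [S] with support in [E] at distance less than [e] from [T]: where the coefficient of [S]
    vanishes, that of [T] has modulus below [e]. So [supp S] serves. *)
Lemma roe_coef (X : choiceType) (E : set (set (X * X)))
    (T : bounded_op (ell2 R X) (ell2 R X)) (e : R) :
  0 < e -> uniform_roe E T -> exists2 A, E A &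
    forall x y, e <= normc (T (delta R x) y) -> A (x, y).
Proof.
move=> e0 ET.
have e0C : 0 < e%:C :> R[i] by rewrite ltcR.
have [S [ES TS]] := ET _ (nbhsx_ballx T _ e0C).
exists (supp S) => // x y Txy.
rewrite /supp /= dot_deltar; apply/negP => /eqP S0.
have : op_norm (T - S) < e.
  by move: TS; rewrite -ball_normE /= /Num.norm /= ltcR.
apply/negP; rewrite -leNgt; apply: le_trans Txy _.
apply: le_trans (op_norm_delta _ x).
have -> : T (delta R x) y = (T - S) (delta R x) y.
  by rewrite [(T - S) _]/(T (delta R x) - S (delta R x)) ell2BE S0 subr0.
exact: normc_le_ell2_norm.
Qed.

End Operators.

(** * Counting points, fibres and large values *)

Section Counting.
Variable R : realType.

Lemma uniq_pmap (A B : eqType) (f : A -> option B) (s : seq A) :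
  (forall x x' y, f x = Some y -> f x' = Some y -> x = x') ->
  uniq s -> uniq (pmap f s).
Proof.
move=> finj; elim: s => //= x s IH /andP[xs us].
case fx: (f x) => [y|] /=; last exact: IH.
rewrite IH// andbT mem_pmap; apply/negP => /mapP[x' x's] /esym fx'.
by rewrite (finj _ _ _ fx fx') x's in xs.
Qed.

Lemma big_pmap_oapp (A B : Type) (f : A -> option B) (s : seq A) (F : B -> R) :
  \sum_(y <- pmap f s) F y = \sum_(x <- s) oapp F 0 (f x).
Proof.
elim: s => [|x s IH] /=; first by rewrite !big_nil.
by rewrite big_cons; case: (f x) => [y|]/=; rewrite ?big_cons ?add0r IH.
Qed.

(** A cardinality bound phrased through duplicate-free lists, the form in which the finite sums are
    written. *)
Definition card_at_most (T : eqType) (A : set T) (n : nat) :=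
  forall s : seq T, uniq s -> {in s, forall x, A x} -> (size s <= n)%N.

Lemma card_at_most_le (T : choiceType) (A : set T) (n : nat) :
  A #<= `I_n -> card_at_most A n.
Proof.
move=> /pcard_leP[f] s us sA.
have fs : {subset map f s <= iota 0 n}.
  by move=> _ /mapP[x /sA Ax ->]; rewrite mem_iota; exact: (@funS _ _ _ _ f x Ax).
rewrite -(size_map f) -[leqRHS](size_iota 0). apply: uniq_leq_size => //.
rewrite map_inj_in_uniq// => x y /sA/mem_set Ax /sA/mem_set Ay; exact: 'inj_f Ax Ay.
Qed.

(** Chebyshev's inequality: [n] such points contribute at least [n] times [d ^+ 2] to a sum bounded
    by [M]. *)
Lemma card_at_most_level (T : eqType) (f : T -> R) (M d : R) :
  0 < d -> (forall s, uniq s -> \sum_(x <- s) f x ^+ 2 <= M) ->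
  card_at_most [set x | d <= f x] (Num.truncn (M / d ^+ 2)).
Proof.
move=> d0 fM s us sd.
have dM : (size s)%:R <= M / d ^+ 2.
  rewrite ler_pdivlMr ?exprn_gt0//; apply: le_trans (fM s us).
  rewrite mulr_natl -(count_predT s) -iter_addr_0 -big_const_seq !big_seq.
  apply: ler_sum => x xs; have dx := sd x xs.
  by rewrite ler_sqr ?nnegrE// ltW// (lt_le_trans d0).
by rewrite truncn_ge_nat// (le_trans _ dM).
Qed.

Lemma card_at_most1 (T : eqType) (S : set T) :
  (forall x y, S x -> S y -> x = y) -> card_at_most S 1.
Proof.
move=> S1 [|x [|y s]]//= /andP[+ _] sS.
by rewrite (S1 x y) ?mem_head//; apply: sS; rewrite !inE eqxx ?orbT.
Qed.

Lemma sum_fibers_le (J : eqType) (T : eqType) (f : J -> T) (F : T -> R) n s :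
  (forall y, 0 <= F y) ->
  (forall y, card_at_most [set j | f j = y] n) -> uniq s ->
  \sum_(j <- s) F (f j) <= n%:R * \sum_(y <- undup (map f s)) F y.
Proof.
move=> F0 fn us.
rewrite (eq_big_seq (fun j =>
    \sum_(y <- undup (map f s)) if f j == y then F y else 0));
  last first.
  move=> j js; rewrite (bigD1_seq (f j)) ?undup_uniq ?mem_undup ?map_f//= eqxx.
  by rewrite big1 ?addr0// => y; rewrite eq_sym => /negbTE ->.
rewrite exchange_big /= mulr_sumr; apply: ler_sum => y _.
rewrite -big_mkcond -big_filter /= big_const_seq count_predT iter_addr_0.
rewrite -[leLHS]mulr_natl ler_wpM2r// ler_nat.
apply: (fn y); first exact: filter_uniq.
by move=> j; rewrite mem_filter => /andP[/eqP].
Qed.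

Lemma sum_fibers_le_const (J : eqType) (T : eqType) (f : J -> T) (F : T -> R) n M s :
  (forall y, 0 <= F y) -> (forall t, uniq t -> \sum_(y <- t) F y <= M) ->
  (forall y, card_at_most [set j | f j = y] n) -> uniq s ->
  \sum_(j <- s) F (f j) <= n%:R * M.
Proof.
move=> F0 FM fn us; apply: le_trans (sum_fibers_le F0 fn us) _.
by rewrite ler_wpM2l// FM// undup_uniq.
Qed.

(** Used repeatedly, this counts tuples one coordinate at a time. *)
Lemma card_at_most_fibers (J T : eqType) (S : set J) (f : J -> T) (B : set T) n m :
  card_at_most B n -> (forall j, S j -> B (f j)) ->
  (forall y, B y -> card_at_most [set j | S j /\ f j = y] m) ->
  card_at_most S (n * m).
Proof.
move=> Bn SB Sm s us sS.
pose t := undup (map f s).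
have tB y : y \in t -> B y by rewrite mem_undup => /mapP[j /sS /SB ? ->].
apply: (@leq_trans (\sum_(y <- t) m)); last first.
  rewrite big_const_seq count_predT iter_addn_0 mulnC leq_mul2r.
  by rewrite Bn ?orbT ?undup_uniq// => y /tB.
have -> : size s = (\sum_(y <- t) count (fun j => f j == y) s)%N.
  under eq_bigr do rewrite -sum1_count big_mkcond /=.
  rewrite exchange_big /= -sum1_size; apply: eq_big_seq => j js.
  rewrite (bigD1_seq (f j)) ?undup_uniq ?mem_undup ?map_f//= eqxx.
  by rewrite big1 ?addn0// => y; rewrite eq_sym => /negbTE ->.
rewrite !big_seq; apply: leq_sum => y yt.
rewrite -size_filter; apply: (Sm y (tB y yt)); first exact: filter_uniq.
by move=> j; rewrite mem_filter => /andP[/eqP ? /sS].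
Qed.

End Counting.

(** * Partial isometries given by partial injections *)

Section PartialTranslations.
Variables (R : realType) (X : choiceType) (t : X -> option X).
Hypothesis t_inj : forall x x' y, t x = Some y -> t x' = Some y -> x = x'.

(** Pullback along [t], with value 0 where [t] is undefined. It sends the basis vector at [y] to the
    one at [x] when [t x = Some y], and injectivity of [t] makes it a contraction. *)
Definition ptrans_fun (g : X -> R[i]) : X -> R[i] := fun x => oapp g 0 (t x).

Lemma ptrans_sum_sqr_le (g : ell2 R X) s : uniq s ->
  \sum_(x <- s) normc (ptrans_fun g x) ^+ 2 <= ell2_norm g ^+ 2.
Proof.
move=> us; apply: le_trans (sum_sqr_le_norm g (uniq_pmap t_inj us)).
rewrite big_pmap_oapp le_eqVlt; apply/orP; left; apply/eqP.
apply: eq_bigr => x _; rewrite /ptrans_fun.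
have n0 : normc (0 : R[i]) ^+ 2 = 0 by rewrite normc0 expr0n.
by case: (t x) => [//|]; exact: n0.
Qed.

Lemma ptrans_subproof (g : ell2 R X) : ptrans_fun g \in @ell2_pred R X.
Proof.
rewrite inE /=; apply: le_lt_trans (ltry (ell2_norm g ^+ 2)).
by apply: sqsum_le_seq; exact: ptrans_sum_sqr_le.
Qed.

Definition ptrans_ell2 (g : ell2 R X) : ell2 R X := Ell2 (ptrans_subproof g).

Lemma ptrans_op_subproof : ptrans_ell2 \in @bounded_op_pred R (ell2 R X) (ell2 R X).
Proof.
rewrite inE /=; split.
  move=> k f g; apply/val_inj/funext => x.
  rewrite [LHS]/(ptrans_fun _ x) [RHS]/(k * ptrans_fun f x + ptrans_fun g x).
  have n0 : 0 = k * 0 + 0 by rewrite mulr0 addr0.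
  by rewrite /ptrans_fun; case: (t x) => [//|]; exact: n0.
exists 1 => g; rewrite mul1r /Num.norm /= lecR.
by apply: ell2_norm_le; [exact: ell2_norm_ge0|exact: ptrans_sum_sqr_le].
Qed.

Definition ptrans : bounded_op (ell2 R X) (ell2 R X) := BoundedOp ptrans_op_subproof.

Lemma ptransE g x : ptrans g x = oapp g 0 (t x). Proof. by []. Qed.

Lemma supp_ptrans x y : supp ptrans (x, y) -> t y = Some x.
Proof.
rewrite /supp /= dot_deltar ptransE; case: (t y) => [z|]/=; last by rewrite eqxx.
by have [->//|zx] := eqVneq z x; rewrite /delta_fun (negbTE zx) eqxx.
Qed.

End PartialTranslations.

(** * Carrying entourages across the unitary *)

Section Transfer.
Variable R : realType.

(** Row and column sums are bounded by splitting the product with [x * y <= x ^+ 2 + y ^+ 2]: with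
    [i] fixed, the squares are summed over the fibres of [a] and [b]; with [j] fixed, over those of
    [p] and [q]. The two indicators keep indices with a common [a] or [b] apart once [eps < 1]. *)
Lemma paving_quadruples (J X Y : choiceType) (u : X -> Y -> R)
    (a b : J -> X) (p q : J -> Y) (M eps : R) (na nb np nq : nat) :
  0 < eps -> 0 <= M -> (forall x y, 0 <= u x y) ->
  (forall x t, uniq t -> \sum_(y <- t) u x y ^+ 2 <= M) ->
  (forall y t, uniq t -> \sum_(x <- t) u x y ^+ 2 <= M) ->
  (forall x, card_at_most [set j | a j = x] na) ->
  (forall x, card_at_most [set j | b j = x] nb) ->
  (forall y, card_at_most [set j | p j = y] np) ->
  (forall y, card_at_most [set j | q j = y] nq) ->
  exists k (c : J -> 'I_k.+1), forall i s, uniq s ->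
    (forall j, j \in s -> j != i /\ c j = c i) ->
    \sum_(j <- s) ((a j == a i)%:R + (b j == b i)%:R +
                   u (a j) (p i) * u (b j) (q i)) <= eps.
Proof.
move=> e0 M0 u0 uM1 uM2 ca cb cp cq.
have ind1 (T : choiceType) (x : T) t : uniq t -> \sum_(y <- t) (y == x)%:R <= 1 :> R.
  move=> ut; have [xt|xt] := boolP (x \in t).
    by rewrite (bigD1_seq x)//= eqxx big1 ?addr0// => y /negbTE ->.
  rewrite big1_seq ?ler01// => y /= yt.
  by case: eqVneq => // yx; rewrite -yx yt in xt.
have amgm (x y : R) : x * y <= x ^+ 2 + y ^+ 2 by nra.
apply: (@paving _ _ (fun i j => (a j == a i)%:R + (b j == b i)%:R +
   u (a j) (p i) * u (b j) (q i))
  (na%:R * 1 + nb%:R * 1 + (na%:R * M + nb%:R * M + (np%:R * M + nq%:R * M)))) => //.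
- by move=> i j; rewrite !addr_ge0 ?mulr_ge0.
- move=> i s us; rewrite !big_split /=; apply: lerD; first apply: lerD.
  + by apply: (sum_fibers_le_const (F := fun x => (x == a i)%:R)
      _ _ ca us) => // t; exact: ind1.
  + by apply: (sum_fibers_le_const (F := fun x => (x == b i)%:R)
      _ _ cb us) => // t; exact: ind1.
  + apply: (@le_trans _ _ (na%:R * M + nb%:R * M)); last first.
      by rewrite lerDl !(addr_ge0, mulr_ge0).
    apply: le_trans (ler_sum _ (fun j _ => amgm _ _)) _.
    rewrite big_split /=; apply: lerD.
    * by apply: (sum_fibers_le_const (F := fun x => u x (p i) ^+ 2)
        _ _ ca us) => [x|]; [exact: sqr_ge0|exact: uM2].
    * by apply: (sum_fibers_le_const (F := fun x => u x (q i) ^+ 2)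
        _ _ cb us) => [x|]; [exact: sqr_ge0|exact: uM2].
- move=> j s us; rewrite !big_split /=; apply: lerD; first apply: lerD.
  + under eq_bigr do rewrite eq_sym.
    by apply: (sum_fibers_le_const (F := fun x => (x == a j)%:R)
      _ _ ca us) => // t; exact: ind1.
  + under eq_bigr do rewrite eq_sym.
    by apply: (sum_fibers_le_const (F := fun x => (x == b j)%:R)
      _ _ cb us) => // t; exact: ind1.
  + apply: (@le_trans _ _ (np%:R * M + nq%:R * M)); last first.
      by rewrite lerDr !(addr_ge0, mulr_ge0).
    apply: le_trans (ler_sum _ (fun i _ => amgm _ _)) _.
    rewrite big_split /=; apply: lerD.
    * by apply: (sum_fibers_le_const (F := fun y => u (a j) y ^+ 2)
        _ _ cp us) => [x|]; [exact: sqr_ge0|exact: uM1].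
    * by apply: (sum_fibers_le_const (F := fun y => u (b j) y ^+ 2)
        _ _ cq us) => [x|]; [exact: sqr_ge0|exact: uM1].
Qed.

Lemma coarse_bigcup (X : Type) (E : set (set (X * X))) (k : nat)
    (B : 'I_k -> set (X * X)) :
  coarse_structure E -> (forall l, E (B l)) -> E (\bigcup_l B l).
Proof.
move=> cE EB; rewrite -bigsetU_fset_set; last exact: finite_finset.
apply: (big_ind E) => //; last exact: coarse_union.
by apply: coarse_subset (coarse_diagonal cE).
Qed.

Definition large_coef (X Y : choiceType) (U : bounded_op (ell2 R X) (ell2 R Y))
    (d : R) (x : X) (y : Y) : Prop := d <= normc (U (delta R x) y).

Lemma large_coef_ex (X Y : choiceType) (U : bounded_op (ell2 R X) (ell2 R Y)) :
  (0 < ereal_inf (range (fun x => ereal_sup (range (fun y =>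
          (normc (dot (U (delta R x)) (delta R y)))%:E)))))%E ->
  exists2 d, 0 < d & forall x, exists y, large_coef U d x y.
Proof.
set r := ereal_inf _ => r0.
have [d d0 dr] : exists2 d : R, 0 < d & (d%:E < r)%E.
  (* The infimum is [+oo] when [X] is empty, and then any positive constant works. *)
  case: r r0 => [r r0| |//]; last by exists 1 => //; exact: ltry.
  by exists (r / 2); [rewrite divr_gt0|rewrite lte_fin;
    move: r0; rewrite lte_fin; lra].
exists d => // x.
have /ereal_sup_gt[_ [y _ <-]] : (d%:E < ereal_sup (range (fun y =>
    (normc (dot (U (delta R x)) (delta R y)))%:E)))%E.
  by apply: lt_le_trans dr _; apply: ereal_inf_lbound; exists x.
by rewrite dot_deltar lte_fin => /ltW dy; exists y.
Qed.

(** Applied to [U] and to [Us], this makes both maps coarse; applied to the diagonals, it makes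
    their composites close to the identities. *)
Lemma large_coef_entourage (X Y : choiceType)
    (E : set (set (X * X))) (F : set (set (Y * Y)))
    (U : bounded_op (ell2 R X) (ell2 R Y)) (Us : bounded_op (ell2 R Y) (ell2 R X))
    (A : set (X * X)) (d : R) :
  coarse_structure E -> coarse_structure F -> uniformly_locally_finite E ->
  (forall x y, normc (Us (delta R y) x) = normc (U (delta R x) y)) ->
  (forall T, uniform_roe E T -> uniform_roe F (comp_op (comp_op U T) Us)) ->
  0 < d -> E A ->
  F [set yy | exists2 xx, A xx &
      large_coef U d xx.1 yy.1 /\ large_coef U d xx.2 yy.2].
Proof.
move=> cE cF ulfE UsE UT d0 EA.
pose u x y := normc (U (delta R x) y).
pose J : choiceType := {j : (X * X) * (Y * Y) |
  `[< [/\ A j.1, d <= u j.1.1 j.2.1 & d <= u j.1.2 j.2.2] >]}.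
pose a (j : J) := (val j).1.1.
pose b (j : J) := (val j).1.2.
pose p (j : J) := (val j).2.1.
pose q (j : J) := (val j).2.2.
have JP j : [/\ A (a j, b j), d <= u (a j) (p j) & d <= u (b j) (q j)].
  by have /asboolP := valP j; rewrite /a /b /p /q; case: (val j) => [[? ?] [? ?]].
have J_inj j j' : a j = a j' -> b j = b j' -> p j = p j' -> q j = q j' -> j = j'.
  rewrite /a /b /p /q => h1 h2 h3 h4; apply: val_inj; move: h1 h2 h3 h4.
  by case: (val j) (val j') => [[? ?] [? ?]] [[? ?] [? ?]] /= -> -> -> ->.
pose M := op_norm U ^+ 2 + op_norm Us ^+ 2.
have M0 : 0 <= M by rewrite addr_ge0 ?sqr_ge0.
have u0 x y : 0 <= u x y by exact: normc_ge0.
have uM1 x t : uniq t -> \sum_(y <- t) u x y ^+ 2 <= M.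
  move=> ut; apply: le_trans (sum_sqr_le_norm _ ut) _.
  apply: ler_wpDr; first exact: sqr_ge0.
  by rewrite ler_sqr ?nnegrE ?ell2_norm_ge0 ?op_norm_ge0// op_norm_delta.
have uM2 y t : uniq t -> \sum_(x <- t) u x y ^+ 2 <= M.
  move=> ut; under eq_bigr do rewrite /u -UsE.
  apply: le_trans (sum_sqr_le_norm _ ut) _.
  apply: ler_wpDl; first exact: sqr_ge0.
  by rewrite ler_sqr ?nnegrE ?ell2_norm_ge0 ?op_norm_ge0// op_norm_delta.
have [n1 An1] := ulfE _ EA.
have [n2 An2] := ulfE _ (coarse_inverse cE EA).
have {}An1 x := card_at_most_le (An1 x).
have {}An2 x := card_at_most_le (An2 x).
pose m := Num.truncn (M / d ^+ 2).
have um1 x : card_at_most [set y | d <= u x y] m.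
  by apply: card_at_most_level => //; exact: uM1.
have um2 y : card_at_most [set x | d <= u x y] m.
  by apply: (card_at_most_level (f := u^~ y)) => //; exact: uM2.
(* Once [a j] is given, there are at most [n1] choices for [b j], then [m] for each of [p j] and
   [q j], and these determine [j]. The next three counts follow the same pattern from another
   starting coordinate. *)
have ca x : card_at_most [set j | a j = x] (n1 * (m * (m * 1))).
  apply: (card_at_most_fibers (f := b) (An1 x)) => [j <-|y _].
    by have [] := JP j.
  apply: (card_at_most_fibers (f := p) (um1 x)) => [j [<- _]|z _].
    by have [] := JP j.
  apply: (card_at_most_fibers (f := q) (um1 y)) => [j [[_ <-] _]|t _].
    by have [] := JP j.
  by apply: card_at_most1 => j j' [[[<- <-] <-] <-] [[[? ?] ?] ?]; exact: J_inj.
have cb x : card_at_most [set j | b j = x] (n2 * (m * (m * 1))).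
  apply: (card_at_most_fibers (f := a) (An2 x)) => [j <-|y _].
    by have [] := JP j.
  apply: (card_at_most_fibers (f := p) (um1 y)) => [j [_ <-]|z _].
    by have [] := JP j.
  apply: (card_at_most_fibers (f := q) (um1 x)) => [j [[<- _] _]|t _].
    by have [] := JP j.
  by apply: card_at_most1 => j j' [[[<- <-] <-] <-] [[[? ?] ?] ?]; exact: J_inj.
have cp y : card_at_most [set j | p j = y] (m * (n1 * (m * 1))).
  apply: (card_at_most_fibers (f := a) (um2 y)) => [j <-|x _].
    by have [] := JP j.
  apply: (card_at_most_fibers (f := b) (An1 x)) => [j [_ <-]|x' _].
    by have [] := JP j.
  apply: (card_at_most_fibers (f := q) (um1 x')) => [j [[_ _] <-]|t _].
    by have [] := JP j.
  by apply: card_at_most1 => j j' [[[<- <-] <-] <-] [[[? ?] ?] ?]; exact: J_inj.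
have cq y : card_at_most [set j | q j = y] (m * (n2 * (m * 1))).
  apply: (card_at_most_fibers (f := b) (um2 y)) => [j <-|x' _].
    by have [] := JP j.
  apply: (card_at_most_fibers (f := a) (An2 x')) => [j [_ <-]|x _].
    by have [] := JP j.
  apply: (card_at_most_fibers (f := p) (um1 x)) => [j [_ <-]|t _].
    by have [] := JP j.
  by apply: card_at_most1 => j j' [[[<- <-] <-] <-] [[[? ?] ?] ?]; exact: J_inj.
(* Below 1, so that the indicators separate indices within a class; at most [d ^+ 2 / 2], so that
   half of the main term survives. *)
pose eps := Num.min (d ^+ 2 / 2) (1 / 2).
have e0 : 0 < eps by rewrite lt_min !divr_gt0 ?exprn_gt0.
have e1 : eps < 1.
  by apply: (@le_lt_trans _ _ (1 / 2)); rewrite ?ge_min ?lexx ?orbT//; lra.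
have ed : eps <= d ^+ 2 / 2 by rewrite ge_min lexx.
have [k [c cP]] := paving_quadruples e0 M0 u0 uM1 uM2 ca cb cp cq.
have c_sep i j : c i = c j -> a i = a j \/ b i = b j -> i = j.
  move=> cij ab; apply/eqP; apply: contrapT => /negP ij.
  have := cP j [:: i] isT; rewrite big_seq1 => /(_ _)/le_lt_trans/(_ e1).
  rewrite ltNge; move=> /(_ _)/negP; apply.
    by move=> i'; rewrite inE => /eqP ->.
  have uu : 0 <= u (a i) (p j) * u (b i) (q j) by rewrite mulr_ge0.
  by move: uu; case: ab => ->; rewrite eqxx; case: (_ == _) => /=; lra.
(* [sel (l, x)] is the only index of class [l] with second point [x], if there is one; uniqueness is
   [c_sep]. *)
have /choice[sel selP] : forall lx : 'I_k.+1 * X, exists o : option J,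
    forall j, o = Some j <-> c j = lx.1 /\ b j = lx.2.
  move=> [l x] /=; have [[j [cj bj]]|nj] := pselect (exists j, c j = l /\ b j = x).
    exists (Some j) => j'; split => [[<-]//|[cj' bj']]; congr Some.
    by apply: c_sep; [rewrite cj|right; rewrite bj].
  by exists None => j; split => // j'; case: nj; exists j.
(* The map goes from second points to first points, so that the support of its [ptrans] lies in [A]
   and not in the inverse of [A]. *)
pose t l x := omap a (sel (l, x)).
have t_inj l x x' y : t l x = Some y -> t l x' = Some y -> x = x'.
  rewrite /t; case s1 : (sel (l, x)) => [j|]//= [<-].
  case s2 : (sel (l, x')) => [j'|]//= [aa].
  have /= [cj <-] := (selP _ _).1 s1; have /= [cj' <-] := (selP _ _).1 s2.
  by congr b; apply: c_sep; [rewrite cj|left].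
have ET l : uniform_roe E (@ptrans R X (t l) (@t_inj l)).
  apply: subset_closure => /=; apply: (coarse_subset cE) EA => -[x y] /supp_ptrans.
  rewrite /t; case s1 : (sel (l, y)) => [j|]//= [<-].
  by have /= [_ <-] := (selP _ _).1 s1; have [] := JP j.
have d2 : 0 < d ^+ 2 / 2 by rewrite divr_gt0 ?exprn_gt0.
have /choice[B BP] l : exists B, F B /\ forall y y', d ^+ 2 / 2 <=
    normc (U (ptrans R (@t_inj l) (Us (delta R y))) y') -> B (y, y').
  by have [B FB BP] := roe_coef d2 (UT _ (ET l)); exists B.
apply: (coarse_subset cF) (coarse_bigcup cF (fun l => (BP l).1)).
move=> [y y'] /= [[x x'] /= Axx' [xy xy']].
have [j [aj bj pj qj]] : exists j : J, [/\ a j = x, b j = x', p j = y & q j = y'].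
  have jP : `[< [/\ A (x, x'), d <= u x y & d <= u x' y'] >] by exact/asboolP.
  by exists (exist _ ((x, x'), (y, y')) jP).
exists (c j) => //; apply: (BP (c j)).2.
set h := Us (delta R y).
have hE x0 : normc (h x0) = u x0 y by rewrite /h UsE.
have tx' : t (c j) x' = Some x.
  by rewrite /t (_ : sel _ = Some j) /= ?aj//; apply/selP.
(* The main term, at [x'], is [u x y * u x' y'], at least [d ^+ 2]. Any other nonzero term comes
   from some [j'] of the class of [j] and is part of the weight that the paving bounds. *)
have := @coef_ge _ _ _ U (ptrans R (@t_inj (c j)) h) y' x' eps.
rewrite ptransE tx' [oapp _ _ _]/(h x) hE => H.
apply: le_trans (H _) => [|s us x's]; last first.
  have sel_inj z z' j' : sel (c j, z) = Some j' -> sel (c j, z') = Some j' -> z = z'.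
    by move=> /selP[_ /= <-] /selP[].
  apply: le_trans (cP j (pmap (fun z => sel (c j, z)) s) (uniq_pmap sel_inj us) _).
    rewrite big_pmap_oapp; apply: ler_sum => z _; rewrite ptransE /t.
    have n0 : normc (0 : R[i]) * normc (U (delta R z) y') <= 0.
      by rewrite normc0 mul0r.
    case sz : (sel (c j, z)) => [j'|]; last exact: n0.
    have /= [_ bj'] := (selP _ _).1 sz.
    rewrite [X in normc X * _]/(h (a j')) hE [leRHS]/= pj qj bj'.
    by rewrite lerDr addr_ge0.
  move=> j'; rewrite mem_pmap => /mapP[z zs /esym sz].
  have /= [cj' bj'] := (selP _ _).1 sz; split => //.
  (* [j' = j] would give [z = x'], which is not in [s]. *)
  by apply: contraNneq x's => jj'; rewrite -bj -jj' bj'.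
have : d ^+ 2 <= u x y * u x' y' by rewrite expr2 ler_pM// ltW.
rewrite -/(u x' y'); move: ed; lra.
Qed.

End Transfer.

(** * The coarse equivalence read off from the large coefficients *)

Theorem corollary4p13 (R : realType) (K : Type) (X Y : choiceType)
    (E : set (set (X * X))) (F : set (set (Y * Y)))
    (hK : infinite_set [set: K]) (hMA : MA K)
    (hE : coarse_structure E) (hF : coarse_structure F)
    (hEgen : card_generated K E) (hFgen : card_generated K F)
    (hEulf : uniformly_locally_finite E) (hFulf : uniformly_locally_finite F)
    (hrigid : rigidly_isomorphic R E F) :
  coarsely_equivalent E F.
Proof.
have [U [Us [[adj UK UsK] bij infU infUs]]] := hrigid.
have UsE x y : normc (Us (delta R y) x) = normc (U (delta R x) y).
  by have := adj (delta R x) (delta R y); rewrite dot_deltar dot_deltal => ->;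
    rewrite normc_conj.
have UT T : uniform_roe E T -> uniform_roe F (comp_op (comp_op U T) Us).
  by case: bij => + _ _; apply.
have UsT S : uniform_roe F S -> uniform_roe E (comp_op (comp_op Us S) U).
  move=> FS; have [T ET <-] : [set comp_op (comp_op U T) Us | T in uniform_roe E] S.
    by case: bij => _ _; apply.
  suff -> : comp_op (comp_op Us (comp_op (comp_op U T) Us)) U = T by [].
  by apply/val_inj/funext => f /=; rewrite !UK.
have [d1 d10 /choice[f fP]] := large_coef_ex infU.
have [d2 d20 /choice[g gP]] := large_coef_ex infUs.
(* A common threshold, because closeness compares coefficients selected by [f] with coefficients
   selected by [g]. *)
pose d := Num.min d1 d2.
have d0 : 0 < d by rewrite lt_min d10.
have {fP}fP x : large_coef U d x (f x).
  by apply: le_trans (fP x); rewrite ge_min lexx.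
have {gP}gP y : large_coef Us d y (g y).
  by apply: le_trans (gP y); rewrite ge_min lexx orbT.
have tE A := large_coef_entourage (A := A) hE hF hEulf UsE UT d0.
have tF A := large_coef_entourage (A := A) hF hE hFulf
  (fun y x => esym (UsE x y)) UsT d0.
exists f; split.
  move=> A EA; apply: ex_intro2 (tE A EA) _.
  by move=> x x' Axx' /=; exists (x, x').
exists g; split.
- move=> A FA; apply: ex_intro2 (tF A FA) _.
  by move=> y y' Ayy' /=; exists (y, y').
(* Both [g (f x)] and [x] have a large coefficient at the same point [f x], so the pair comes from
   the diagonal of [Y]; the last case is symmetric. *)
- apply: (coarse_subset hE) (tF _ (coarse_diagonal hF)) => _ [x _ <-] /=.
  by exists (f x, f x) => //=; split; [exact: gP|];
    rewrite /large_coef UsE; exact: fP.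
- apply: (coarse_subset hF) (tE _ (coarse_diagonal hE)) => _ [y _ <-] /=.
  by exists (g y, g y) => //=; split; [exact: fP|];
    rewrite /large_coef -UsE; exact: gP.
Qed.
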